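(* Let $X,Y$ be finite, $\mu,\nu$ with full support, $c:X\times Y\to\mathbb{R}$, $\varepsilon>0$, and let $\varphi_1,\varphi_2$ be entropy functions each of which is non-negative, finite on $[0,\infty)$, and continuously differentiable on the interior of its domain. Let $\{X_i\}_{i\in I}$ be a basic partition of $X$, let $\mathcal{J}_A,\mathcal{J}_B$ be two composite partitions, and let $\pi_{\mathrm{init}}\in\mathcal{M}_+(X\times Y)$ be feasible, i.e. $E(\pi_{\mathrm{init}})<\infty$. Then the sequence $(\pi^k)_k$ generated by the sequential unbalanced domain decomposition algorithm (defined in the context) started from $\pi^0=\pi_{\mathrm{init}}$ converges to the unique global minimizer of the entropic unbalanced optimal transport problem $$\inf_{\pi\in\mathcal{M}_+(X\times Y)}E(\pi).$$
   Context: $\mathcal{M}_+(Z)$ denotes the non-negative finite measures on $Z$. $\langle\phi,\rho\rangle$ is the integral of $\phi$ against $\rho$; $\pi\llcorner S$ is the restriction of $\pi$ to $S$. $\mathrm{P}_X,\mathrm{P}_Y$ are the marginal projections: $(\mathrm{P}_X\pi)(A)=\pi(A\times Y)$, $(\mathrm{P}_Y\pi)(B)=\pi(X\times B)$. $\mu\in\mathcal{M}_+(X)$, $\nu\in\mathcal{M}_+(Y)$. An entropy function is a lower semicontinuous convex function $\varphi:\mathbb{R}\to\mathbb{R}\cup\{\infty\}$ with $\mathrm{dom}(\varphi)\subseteq[0,\infty)$ and $\mathrm{dom}(\varphi)\setminus\{0\}\neq\emptyset$. Set $\varphi'_\infty=\lim_{x\to+\infty}\varphi(x)/x$. The associated divergence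 is $D_\varphi(\rho\mid\sigma)=\int_Z\varphi\left(\frac{\mathrm{d}\rho}{\mathrm{d}\sigma}\right)\mathrm{d}\sigma+\varphi'_\infty\,\rho^\perp(Z)$, where $\rho=\frac{\mathrm{d}\rho}{\mathrm{d}\sigma}\sigma+\rho^\perp$ is the Lebesgue decomposition. Write $D_1=D_{\varphi_1}$, $D_2=D_{\varphi_2}$. For $\rho\ll\sigma$, $\mathrm{KL}(\rho\mid\sigma)=\int\left[\frac{\mathrm{d}\rho}{\mathrm{d}\sigma}\log\frac{\mathrm{d}\rho}{\mathrm{d}\sigma}-\frac{\mathrm{d}\rho}{\mathrm{d}\sigma}+1\right]\mathrm{d}\sigma$ (with $0\log 0=0$), and $+\infty$ otherwise. Global objective: $$E(\pi)=\langle c,\pi\rangle+\varepsilon\,\mathrm{KL}(\pi\mid\mu\otimes\nu)+D_1(\mathrm{P}_X\pi\mid\mu)+D_2(\mathrm{P}_Y\pi\mid\nu).$$ A basic partition $\{X_i\}_{i\in I}$ ($I$ finite) is a partition of $X$ into closed, $\mu$-essentially disjoint subsets with $\mu(X_i)>0$ for all $i$. A composite partition $\mathcal{J}$ is a partition of $I$; for $J\in\mathcal{J}$ the composite cell is $X_J=\bigcup_{i\in J}X_i$ and $\mu_J=\mu\llcorner X_J$. Cell objective, for $\nu_{-J}\in\mathcal{M}_+(Y)$ and $\pi_J\in\mathcal{M}_+(X_J\times Y)$: $$E_J(\pi_J\mid\nu_{-J})=\langle c,\pi_J\rangle+\varepsilon\,\mathrm{KL}(\pi_J\mid\mu_J\otimes\nu)+D_1(\mathrm{P}_X\pi_J\mid\mu_J)+D_2(\mathrm{P}_Y\pi_J+\nu_{-J}\mid\nu).$$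 In this setting $E_J(\cdot\mid\nu_{-J})$ has a unique minimizer. Sequential unbalanced domain decomposition algorithm: set $\pi^0=\pi_{\mathrm{init}}$. For $k=1,2,\dots$, let $\mathcal{J}=\mathcal{J}_A$ if $k$ is odd and $\mathcal{J}=\mathcal{J}_B$ if $k$ is even, and obtain $\pi^k$ from $\pi^{k-1}$ as follows. Initialize $\pi'=\pi^{k-1}$. For all $J\in\mathcal{J}$, one after the other (in an order fixed for each partition): set $\pi_J=\pi'\llcorner(X_J\times Y)$, $\nu_{-J}=\mathrm{P}_Y(\pi'-\pi_J)$, $\tilde\pi_J=\operatorname{argmin}_{\hat\pi_J\in\mathcal{M}_+(X_J\times Y)}E_J(\hat\pi_J\mid\nu_{-J})$, and replace $\pi'$ by $\pi'-\pi_J+\tilde\pi_J$. After all cells have been processed, $\pi^k=\pi'$. *)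

(* Defs.v *)
From mathcomp Require Import all_boot all_order all_algebra.
From mathcomp Require Import all_classical all_reals all_analysis.

Set Implicit Arguments.
Unset Strict Implicit.
Unset Printing Implicit Defensive.

Import Order.TTheory GRing.Theory Num.Theory.
Import numFieldNormedType.Exports.

Local Open Scope classical_set_scope.
Local Open Scope ring_scope.

(** * Entropy functions *)

Section Entropy.
Variable R : realType.
Implicit Type phi : R -> \bar R.

Definition dom phi : set R := [set x | (phi x < +oo)%E].

(* mathcomp-analysis' [convex_function] is restricted to real-valued functions.
   The endpoints t = 0, 1 are harmless since 0 * +oo = 0 in [\bar R]. *)
Definition econvex phi : Prop :=
  forall (x y t : R), 0 <= t <= 1 ->
    (phi (t * x + (1 - t) * y)%R <= t%:E * phi x + (1 - t)%:E * phi y)%E.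

Definition entropy_function phi : Prop :=
  [/\ forall x, phi x != -oo%E,
      lower_semicontinuous phi,
      econvex phi,
      dom phi `<=` [set x | 0 <= x] &
      dom phi `\ 0 !=set0].

Definition recession phi : \bar R :=
  lim ((phi x * (x^-1)%:E)%E @[x --> +oo%R]).

Definition C1_on_interior_dom phi : Prop :=
  forall x : R, (dom phi)° x ->
    derivable (fine \o phi) x 1 /\ {for x, continuous (derive1 (fine \o phi))}.

End Entropy.

(** * Measures on finite sets *)

(* A finite measure on a finite set Z (with its discrete topology) is encoded by
   its point masses rho z = rho({z}); signed measures, such as differences of
   non-negative ones, are arbitrary elements of {ffun Z -> R}. *)

Section Measures.
Variables (R : realType) (Z : finType).
Implicit Types (rho sigma : {ffun Z -> R}) (A : {set Z}).

Definition Mplus : set {ffun Z -> R} := [set rho | forall z, 0 <= rho z].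

(* M_+(A), viewed inside M_+(Z) through extension by zero. *)
Definition Mplus_on A : set {ffun Z -> R} :=
  [set rho | Mplus rho /\ forall z, z \notin A -> rho z = 0].

Definition mass rho A : R := \sum_(z in A) rho z.

Definition restr rho A : {ffun Z -> R} :=
  [ffun z => if z \in A then rho z else 0].

Definition pairing (f : Z -> R) rho : R := \sum_z f z * rho z.

(* Lebesgue decomposition rho = dens rho sigma * sigma + sing rho sigma; the
   value of the density on the sigma-null set, here 0 = rho z / 0, is
   irrelevant. *)
Definition dens rho sigma (z : Z) : R := rho z / sigma z.
Definition sing rho sigma : {ffun Z -> R} :=
  [ffun z => if sigma z == 0 then rho z else 0].

Lemma lebesgue_decomposition rho sigma z :
  rho z = dens rho sigma z * sigma z + sing rho sigma z.
Proof.
rewrite ffunE /dens; case: eqP => [->|/eqP sz0]; first by rewrite mulr0 add0r.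
by rewrite divfK// addr0.
Qed.

Definition abs_cont rho sigma : bool :=
  [forall z, (sigma z == 0) ==> (rho z == 0)].

Definition divergence (phi : R -> \bar R) rho sigma : \bar R :=
  (\sum_z phi (dens rho sigma z) * (sigma z)%:E
   + recession phi * (mass (sing rho sigma) [set: Z]%SET)%:E)%E.

Definition KL rho sigma : \bar R :=
  if abs_cont rho sigma then
    (\sum_z (dens rho sigma z * ln (dens rho sigma z) - dens rho sigma z + 1)
            * sigma z)%:E
  else +oo%E.

End Measures.
Arguments Mplus {R Z}.
Arguments Mplus_on {R Z} A.

Definition is_minimizer (R : realType) (T : Type) (S : set T)
    (F : T -> \bar R) (p : T) : Prop :=
  S p /\ forall q, S q -> (F p <= F q)%E.

Section UnbalancedOT.
Variables (R : realType) (X Y : finType).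
Variables (c : X * Y -> R) (eps : R) (phi1 phi2 : R -> \bar R).
Variables (mu : {ffun X -> R}) (nu : {ffun Y -> R}).
Implicit Type pi : {ffun X * Y -> R}.

Definition PX pi : {ffun X -> R} := [ffun x => \sum_y pi (x, y)].
Definition PY pi : {ffun Y -> R} := [ffun y => \sum_x pi (x, y)].

Definition prod_meas (a : {ffun X -> R}) (b : {ffun Y -> R}) :
  {ffun X * Y -> R} := [ffun z => a z.1 * b z.2].

Definition E_glob pi : \bar R :=
  ((pairing c pi)%:E + eps%:E * KL pi (prod_meas mu nu)
   + divergence phi1 (PX pi) mu + divergence phi2 (PY pi) nu)%E.

(** * Partitions *)

Variables (I : finType) (Xs : I -> {set X}).

(* Every subset of the finite discrete space X is closed. *)
Definition basic_partition : Prop :=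
  [/\ (\bigcup_i Xs i)%SET = [set: X]%SET,
      forall i j, i != j -> mass mu (Xs i :&: Xs j)%SET = 0 &
      forall i, 0 < mass mu (Xs i)].

Definition cell (J : {set I}) : {set X} := (\bigcup_(i in J) Xs i)%SET.

Definition cellY (J : {set I}) : {set X * Y} := finset.setX (cell J) [set: Y]%SET.

Definition E_cell (J : {set I}) (nuJ : {ffun Y -> R}) pi : \bar R :=
  ((pairing c pi)%:E + eps%:E * KL pi (prod_meas (restr mu (cell J)) nu)
   + divergence phi1 (PX pi) (restr mu (cell J))
   + divergence phi2 (PY pi + nuJ)%R nu)%E.

(** * The sequential domain decomposition algorithm *)

(* [xget] selects an element of the set of minimizers (0 if there is none). *)
Definition argmin_cell (J : {set I}) (nuJ : {ffun Y -> R}) :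
    {ffun X * Y -> R} :=
  xget 0 (is_minimizer (Mplus_on (cellY J)) (E_cell J nuJ)).

Definition cell_update pi (J : {set I}) : {ffun X * Y -> R} :=
  let piJ := restr pi (cellY J) in
  let nuJ := PY (pi - piJ) in
  pi - piJ + argmin_cell J nuJ.

Definition sweep (order : seq {set I}) pi : {ffun X * Y -> R} :=
  foldl cell_update pi order.

Fixpoint domdec (orderA orderB : seq {set I}) (pi_init : {ffun X * Y -> R})
    (k : nat) : {ffun X * Y -> R} :=
  if k is k'.+1 then
    sweep (if odd k then orderA else orderB) (domdec orderA orderB pi_init k')
  else pi_init.

End UnbalancedOT.

(* Main.v *)
Require Import Defs.
From mathcomp Require Import all_boot all_order all_algebra.
From mathcomp Require Import all_classical all_reals all_analysis.
From mathcomp Require Import ring lra.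

Set Implicit Arguments.
Unset Strict Implicit.
Unset Printing Implicit Defensive.

Import Order.TTheory GRing.Theory Num.Theory.
Import numFieldNormedType.Exports.

Local Open Scope classical_set_scope.
Local Open Scope ring_scope.

(** On a finite space every quantity is finite, so the global objective is a
    real function of the point masses: a linear cost, plus [eps] times a
    weighted sum of [kl (p z / w z)] with [kl t = t ln t - t + 1], plus convex
    functions of the marginal masses ([obj], [uotE]).  Replacing the part of
    the plan that lives on a composite cell by the minimizer of the cell
    objective is the same as minimizing this function over the plans that agree
    with the current one off the cell ([cell_update_block_min]).  The algorithm
    is therefore block coordinate descent, and it converges for three reasons.

    - [kl] is superlinear, so sublevel sets are bounded ([sublevel_bounded]),
      and on a bounded set it is strongly convex, so that an update decreases
      the objective by at least a multiple of the squared step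
      ([block_min_descent]).  As the objective decreases to a limit, the steps
      tend to zero: all the plans inside a sweep share their limit points, and
      a limit point is minimal with respect to every cell of the partition
      ([block_min_limit], [sweep_limit_block_min]).
    - [kl] has slope minus infinity at zero, whereas a convex entropy
      has difference quotients bounded above, so a blockwise minimal plan is
      positive everywhere ([block_min_gt0]).
    - At a positive plan the objective is differentiable, because the marginals
      are positive too.  Blockwise minimality annihilates each partial
      derivative and convexity then gives global minimality
      ([blockwise_min_global]).  Without differentiability in the marginals a
      blockwise minimal point may fail to be a global minimizer.

    The cells of the first partition already cover the space, so the argument
    runs along the plans that precede its sweeps.  The objective thus converges
    to its minimum, and strong convexity turns this into convergence of the
    whole sequence of plans ([cyclic_sweeps_converge]).

    Limit points are taken along an ultrafilter on the indices that refines the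
    filter of cofinite sets: along it every bounded real sequence converges, so
    no subsequences have to be extracted. *)

(** * The Kullback-Leibler integrand *)

Section KLIntegrand.
Variable R : realType.
Implicit Types t u a M : R.

Definition kl t : R := t * ln t - t + 1.

Lemma ln_le_subr1 t : 0 < t -> ln t <= t - 1.
Proof.
by move=> t0; have := @le_ln1Dx R (t - 1); rewrite (addrC 1) subrK; apply; lra.
Qed.

(** The usual tangent inequality, with the square-root remainder that comes from
    [ln (sqrt (a / t)) <= sqrt (a / t) - 1] in place of [ln (a / t) <= a / t - 1].
    It is a form of strong convexity obtained without second derivatives, and it
    remains meaningful at [t = 0]. *)
Lemma kl_tangent_sqrt a t : 0 < a -> 0 <= t ->
  kl a + ln a * (t - a) + (Num.sqrt t - Num.sqrt a) ^+ 2 <= kl t.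
Proof.
move=> a0; case: (ltgtP 0 t) => // [t0 _|<- _]; last first.
  rewrite /kl sqrtr0 !sub0r sqrrN sqr_sqrtr; [rewrite mul0r; lra|exact: ltW].
have sE (v : R) : 0 < v -> v = Num.sqrt v * Num.sqrt v.
  by move=> v0; rewrite -expr2 sqr_sqrtr// ltW.
have s0 : 0 < Num.sqrt t by rewrite sqrtr_gt0.
have r0 : 0 < Num.sqrt a by rewrite sqrtr_gt0.
have lnE (v : R) : 0 < v -> ln v = 2 * ln (Num.sqrt v).
  by move=> v0; rewrite {1}(sE _ v0) lnM ?posrE ?sqrtr_gt0//; lra.
rewrite /kl (lnE _ a0) (lnE _ t0).
move: (sE _ a0) (sE _ t0); set s := Num.sqrt t in s0 *; set r := Num.sqrt a in r0 *.
move=> -> ->.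
have := ln_le_subr1 (divr_gt0 r0 s0); rewrite ln_div ?posrE// => H.
have {}H : s * s * (ln r - ln s) <= s * s * (r / s - 1).
  by rewrite ler_wpM2l// mulr_ge0// ltW.
have E : s * s * (r / s - 1) = s * r - s * s by field; rewrite gt_eqF.
rewrite E in H; nra.
Qed.

Lemma kl_tangent a t : 0 < a -> 0 <= t -> kl a + ln a * (t - a) <= kl t.
Proof.
by move=> a0 t0; apply: le_trans (kl_tangent_sqrt a0 t0); rewrite lerDl sqr_ge0.
Qed.

(** The tangent at [expR d] has slope [d], which can be any real number. *)
Lemma kl_superlinear (d t : R) : 0 <= t -> d * t - expR d + 1 <= kl t.
Proof.
move=> t0; have := kl_tangent (expR_gt0 d) t0; rewrite /kl expRK; lra.
Qed.

Lemma sqrt_sub_sqr M t a : 0 < M -> 0 <= t <= M -> 0 <= a <= M ->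
  (t - a) ^+ 2 / (4 * M) <= (Num.sqrt t - Num.sqrt a) ^+ 2.
Proof.
move=> M0 /andP[t0 tM] /andP[a0 aM].
rewrite ler_pdivrMr ?mulr_gt0//.
have E : t - a = (Num.sqrt t - Num.sqrt a) * (Num.sqrt t + Num.sqrt a).
  by rewrite -subr_sqr !sqr_sqrtr.
rewrite E exprMn ler_wpM2l ?sqr_ge0//.
have := sqr_sqrtr t0; have := sqr_sqrtr a0.
have := sqr_ge0 (Num.sqrt t - Num.sqrt a).
rewrite !expr2; nra.
Qed.

(** Apply the tangent inequality at the midpoint to both ends: the linear terms
    cancel and the remainders add up. *)
Lemma kl_midpoint M t u : 0 < M -> 0 <= t <= M -> 0 <= u <= M ->
  kl ((t + u) / 2) + (t - u) ^+ 2 / (16 * M) <= (kl t + kl u) / 2.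
Proof.
move=> M0 tM uM; have [t0 t_le] := andP tM; have [u0 u_le] := andP uM.
set a := (t + u) / 2.
have aM : 0 <= a <= M by rewrite /a; lra.
have [a0|a0] := ltP 0 a; last first.
  have -> : t = 0 by move: a0; rewrite /a; lra.
  have -> : u = 0 by move: a0; rewrite /a; lra.
  have -> : a = 0 by move: aM; lra.
  by rewrite subrr expr0n mul0r; lra.
have Ht := le_trans (lerD (lexx _) (sqrt_sub_sqr M0 tM aM)) (kl_tangent_sqrt a0 t0).
have Hu := le_trans (lerD (lexx _) (sqrt_sub_sqr M0 uM aM)) (kl_tangent_sqrt a0 u0).
have Et : (t - a) ^+ 2 / (4 * M) = (t - u) ^+ 2 / (16 * M).
  by rewrite /a; field; rewrite gt_eqF.
have Eu : (u - a) ^+ 2 / (4 * M) = (t - u) ^+ 2 / (16 * M).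
  by rewrite /a; field; rewrite gt_eqF.
rewrite Et in Ht; rewrite Eu in Hu.
have : ln a * (t - a) + ln a * (u - a) = 0 by rewrite /a; field.
lra.
Qed.

Lemma is_derive_kl t : 0 < t -> is_derive t 1 kl (ln t).
Proof.
move=> t0; have := is_derive1_ln t0 => Hln.
have := is_deriveD (is_deriveB (is_deriveM (is_derive_id t (1 : R)) Hln)
  (is_derive_id t (1 : R))) (is_derive_cst (1 : R) t (1 : R)).
set d := (X in is_derive _ _ _ X -> _) => H.
suff <- : d = ln t by [].
by rewrite /d /= /GRing.scale /= divff ?gt_eqF// addr0 mulr1; ring.
Qed.

(** For [t <= 1], [kl t] lies between [1 - 2 sqrt t - t] and [1]; the lower bound
    is again [ln s^-1 <= s^-1 - 1], for [s = sqrt t]. *)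
Lemma kl_cvg0 : kl t @[t --> within [set t | 0 <= t] (nbhs (0 : R))] --> kl 0.
Proof.
have -> : kl 0 = 1 by rewrite /kl mul0r subr0 add0r.
apply: (@squeeze_cvgr _ _ _ _ (fun t => 1 - 2 * Num.sqrt t - t) (fun=> 1)).
- rewrite near_withinE.
  have : \forall t \near (0 : R), t < 1 by apply: lt_nbhsl; exact: ltr01.
  apply: filterS => t t1 /= t0; apply/andP; split; last first.
    by have := ln_le0 (ltW t1); rewrite /kl => ?; nra.
  case: (ltgtP 0 t) t0 => // [t0 _|<- _]; last first.
    by rewrite /kl sqrtr0 mulr0 mul0r; lra.
  have s0 : 0 < Num.sqrt t by rewrite sqrtr_gt0.
  have tE : t = Num.sqrt t * Num.sqrt t by rewrite -expr2 sqr_sqrtr// ltW.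
  rewrite /kl; move: tE; set s := Num.sqrt t in s0 * => ->.
  rewrite lnM ?posrE//.
  have := @ln_le_subr1 s^-1; rewrite invr_gt0 lnV ?posrE// => /(_ s0) H.
  have : s * - ln s <= s * (s^-1 - 1) by rewrite ler_wpM2l// ltW.
  rewrite mulrBr divff ?gt_eqF// => H'; nra.
- have H : (fun t : R => 1 - 2 * Num.sqrt t - t) @ nbhs (0 : R) --> (1 - 2 * Num.sqrt (0:R) - 0).
    apply: cvgB => //; apply: cvgB; first exact: cvg_cst.
    apply: cvgM; [exact: cvg_cst|exact: sqrt_continuous].
  by rewrite sqrtr0 mulr0 !subr0 in H; exact: cvg_within_filter H.
- exact: cvg_cst.
Qed.

Lemma kl_cvg t : 0 <= t -> kl x @[x --> within [set x | 0 <= x] (nbhs t)] --> kl t.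
Proof.
case: (ltgtP 0 t) => // [t0 _|<- _]; last exact: kl_cvg0.
apply: cvg_within_filter.
have /derivable1_diffP/differentiable_continuous : derivable kl t 1.
  by have [] := is_derive_kl t0.
exact.
Qed.

End KLIntegrand.

(** * Derivatives, and limits along filters *)

Lemma is_derive_affine_comp (R : realType) (g : R -> R) (b a t d : R) :
  is_derive (b + a * t) 1 g d -> is_derive t 1 (fun s => g (b + a * s)) (d * a).
Proof.
move=> dg; suff dlin : is_derive t (1 : R) (fun s : R => b + a * s) a.
  exact: (@is_derive1_comp R g (fun s : R => b + a * s) t _ _ dg dlin).
have := is_deriveD (is_derive_cst b t (1 : R))
  (is_deriveM (is_derive_cst a t (1 : R)) (is_derive_id t (1 : R))).
set e := (X in is_derive _ _ _ X -> _).
suff -> : e = a by [].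
by rewrite /e /= /GRing.scale /= mulr1 mulr0 addr0 add0r.
Qed.

Lemma is_derive_fsum (R : realType) (I : finType) (f : I -> R -> R) (t : R)
    (d : I -> R) : (forall i, is_derive t 1 (f i) (d i)) ->
  is_derive t 1 (fun s => \sum_i f i s) (\sum_i d i).
Proof.
move=> df; have -> : (fun s => \sum_i f i s) = \sum_i f i.
  by apply/funext => s; rewrite fct_sumE.
by elim/big_ind2 : _ => // [|] *; [exact: is_derive_cst|exact: is_deriveD].
Qed.

(** The sequence clusters at some [l] by compactness; an ultrafilter contains the
    preimage of each neighborhood of [l] or its complement, and the latter is
    excluded by clustering. *)
Lemma ultra_bounded_cvg (R : realType) (U : set_system nat) (u : nat -> R) M :
  UltraFilter U -> (forall n, 0 <= u n <= M) -> exists l : R, u @ U --> l.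
Proof.
move=> UU u_bd.
have : (u @ U) [set` `[0, M]].
  rewrite /fmap /=; suff -> : u @^-1` [set` `[0, M]] = setT by exact: filterT.
  by apply/seteqP; split => n //= _; rewrite in_itv /=; exact: u_bd.
move/(segment_compact _) => [l [_ clus]]; exists l => A lA.
have [//|UnA] := in_ultra_setVsetC (u @^-1` A) UU.
by have [x []] := clus (~` A) A UnA lA.
Qed.

Lemma fin_cvg_sum (R : realType) (T : Type) (I : finType) (F : set_system T)
    (f : I -> T -> R) (l : I -> R) : Filter F ->
  (forall i, f i x @[x --> F] --> l i) ->
  \sum_i f i x @[x --> F] --> \sum_i l i.
Proof.
move=> FF fl; apply: (@cvg_big _ _ _ _ predT) => // x.
exact: add_continuous.
Qed.

(** * Regular entropies *)

Section RegularEntropy.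
Variable R : realType.
Implicit Types (g : R -> R) (s t l : R).

(** What the proof uses of an entropy, in terms of its finite part: continuity
    includes the end point [0], whereas a derivative exists only inside. *)
Record regular_entropy g : Prop := RegularEntropy {
  regular_ge0 : forall t, 0 <= t -> 0 <= g t;
  regular_convex : forall s t l, 0 <= s -> 0 <= t -> 0 <= l <= 1 ->
    g (l * s + (1 - l) * t) <= l * g s + (1 - l) * g t;
  regular_cvg : forall t, 0 <= t ->
    g s @[s --> within [set s | 0 <= s] (nbhs t)] --> g t;
  regular_derivable : forall t, 0 < t -> derivable g t 1 }.

(** The slopes of a convex function over [[a, a + h (t - a)]] are at most the
    slope over the whole interval; let [h] decrease to zero. *)
Lemma regular_tangent g (a t : R) : regular_entropy g -> 0 < a -> 0 <= t ->
  g a + 'D_1 g a * (t - a) <= g t.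
Proof.
move=> [_ gcvx _ /(_ a) gder] a0 t0; have {}gder := gder a0.
pose phi l : R := g (a + (t - a) * l).
have dphi : is_derive (0 : R) 1 phi ('D_1 g a * (t - a)).
  by apply: is_derive_affine_comp; rewrite mulr0 addr0; exact: derivableP.
have [dphi1 dphiE] := dphi.
have {dphi1 dphiE}H :
    (fun h => h^-1 *: ((phi \o shift 0) (h *: 1) - phi 0)) @ (0 : R)^'+ -->
    'D_1 g a * (t - a).
  apply: cvg_dnbhs_at_right; rewrite -dphiE; exact: dphi1.
rewrite -lerBrDl; apply: (cvgr_to_le H).
near=> h.
have h0 : 0 < h by near: h; exact: nbhs_right_gt.
have h1 : h <= 1 by near: h; apply: nbhs_right_le.
rewrite /= /phi /GRing.scale /= !mulr1 !addr0 mulr0 addr0.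
have := gcvx t a h t0 (ltW a0); rewrite (ltW h0) h1 => /(_ isT).
have -> : h * t + (1 - h) * a = a + (t - a) * h by ring.
move=> H'; rewrite ler_pdivrMl//; nra.
Unshelve. all: by end_near. Qed.

Lemma regular_midpoint g s t : regular_entropy g -> 0 <= s -> 0 <= t ->
  g ((s + t) / 2) <= (g s + g t) / 2.
Proof.
move=> gr s0 t0; have := regular_convex gr s0 t0 (_ : 0 <= 2^-1 <= 1).
have -> : 2^-1 * s + (1 - 2^-1) * t = (s + t) / 2 by field.
by move=> H; apply: (le_trans (H _)); lra.
Qed.

(** Difference quotients in an increasing direction are bounded above, even at
    [s = 0]: this is what the infinite slope of [kl] has to beat. *)
Lemma regular_step g s d l : regular_entropy g -> 0 <= s -> 0 <= d ->
  0 <= l <= 1 -> g (s + l * d) <= g s + l * (g (s + d) - g s).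
Proof.
move=> gr s0 d0 l01; have := regular_convex gr (addr_ge0 s0 d0) s0 l01.
have -> : l * (s + d) + (1 - l) * s = s + l * d by ring.
lra.
Qed.

End RegularEntropy.

(** Only continuity at [0] requires an argument: lower semicontinuity bounds the
    function from below and the chord from [0] to [1] bounds it from above. *)
Lemma entropy_function_regular (R : realType) (phi : R -> \bar R) :
  entropy_function phi -> (forall x, (0 <= phi x)%E) ->
  (forall x, 0 <= x -> (phi x < +oo)%E) -> C1_on_interior_dom phi ->
  regular_entropy (fine \o phi).
Proof.
move=> [_ lsc cvx _ _] ge0 fin C1.
have phiE x : 0 <= x -> phi x = (fine (phi x))%:E.
  by move=> x0; rewrite fineK// ge0_fin_numE// fin.
have cvxR s t l : 0 <= s -> 0 <= t -> 0 <= l <= 1 ->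
    fine (phi (l * s + (1 - l) * t)) <= l * fine (phi s) + (1 - l) * fine (phi t).
  move=> s0 t0 l01; have := cvx s t l l01.
  rewrite (phiE s)// (phiE t)// phiE ?lee_fin//; nra.
have der t : 0 < t -> derivable (fine \o phi) t 1.
  move=> t0; apply: (C1 t _).1.
  apply: (@filterS _ _ _ [set x | 0 < x]); last exact: lt_nbhsr.
  by move=> x /= x0; apply: fin; exact: ltW.
split => //; first by move=> t _; exact: fine_ge0.
move=> t; case: (ltgtP 0 t) => // [t0 _|<- _].
  apply: cvg_within_filter.
  by have /derivable1_diffP/differentiable_continuous := der _ t0; exact.
apply/cvgrPdist_lt => e e0; rewrite near_withinE.
have [V V0 HV] : exists2 V, nbhs (0 : R) V &
    forall y, V y -> ((fine (phi 0) - e)%:E < phi y)%E.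
  by apply: lsc; rewrite [X in (_ < X)%E]phiE// lte_fin gtrBl.
pose K := `|fine (phi 1) - fine (phi 0)| + 1.
have K0 : 0 < K by rewrite ltr_pwDr.
have V1 : \forall x \near (0 : R), x < Num.min 1 (e / K).
  by apply: lt_nbhsl; rewrite lt_min ltr01 divr_gt0.
near=> x => x0 /=.
have /HV : V x by near: x.
rewrite (phiE x)// lte_fin => Hlow.
have : x < Num.min 1 (e / K) by near: x.
rewrite lt_min ltr_pdivlMr// => /andP[x1 xK].
have := @cvxR 1 0 x ler01 (lexx _).
rewrite x0 (ltW x1) mulr1 mulr0 addr0 => /(_ isT) Hup.
have : fine (phi 1) - fine (phi 0) <= K.
  by rewrite /K; have := ler_norm (fine (phi 1) - fine (phi 0)); lra.
move=> /(ler_wpM2l x0) HK; rewrite ltr_distl /=; apply/andP; split; lra.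
Unshelve. all: by end_near. Qed.

(** * Entropically regularized objectives *)

Section RegularizedObjective.
Variables (R : realType) (Z S : finType).
Variables (c : Z -> R) (eps : R) (w : Z -> R).
Variables (v : S -> R) (a : S -> Z -> R) (g : S -> R -> R).
Hypotheses (eps_gt0 : 0 < eps) (w_gt0 : forall z, 0 < w z).
Hypotheses (v_ge0 : forall j, 0 <= v j) (a_ge0 : forall j z, 0 <= a j z).
Hypothesis a_row : forall j, exists z, 0 < a j z.
Hypothesis g_reg : forall j, regular_entropy (g j).
Implicit Types (p q r : {ffun Z -> R}) (A : {set Z}) (M L : R).

Definition lin j p : R := \sum_z a j z * p z.

(** The marginal divergences are treated alike: each marginal mass, divided by
    its reference mass, is a nonnegative linear form [lin j] of the plan, and it
    enters the objective through one convex function [g j]. *)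
Definition obj p : R :=
  \sum_z c z * p z + eps * (\sum_z w z * kl (p z / w z))
  + \sum_j v j * g j (lin j p).

Lemma lin_ge0 j p : Mplus p -> 0 <= lin j p.
Proof. by move=> p0; apply: sumr_ge0 => z _; rewrite mulr_ge0. Qed.

Lemma lin_gt0 j p : (forall z, 0 < p z) -> 0 < lin j p.
Proof.
move=> p0; have [z az] := a_row j; rewrite /lin (bigD1 z)//=.
rewrite ltr_pwDl ?mulr_gt0// sumr_ge0// => y _.
by rewrite mulr_ge0// ltW.
Qed.

(** Use the tangent of [kl] with slope [(1 - c z) / eps], which turns the cost
    [c z * p z] into [p z]. *)
Lemma obj_coercive : exists C : R, forall p, Mplus p -> \sum_z p z <= obj p + C.
Proof.
pose d z := (1 - c z) / eps.
exists (\sum_z eps * w z * (expR (d z) - 1)) => p p0.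
have ridge0 : 0 <= \sum_j v j * g j (lin j p).
  by apply: sumr_ge0 => j _; rewrite mulr_ge0// (regular_ge0 (g_reg j))// lin_ge0.
suff : \sum_z p z <= \sum_z c z * p z + eps * (\sum_z w z * kl (p z / w z)) +
    \sum_z eps * w z * (expR (d z) - 1) by rewrite /obj; lra.
rewrite mulr_sumr -!big_split /=; apply: ler_sum => z _.
have t0 : 0 <= p z / w z by rewrite divr_ge0// ltW.
have := kl_superlinear (d z) t0.
have ew : 0 <= eps * w z by rewrite mulr_ge0// ltW.
move=> /(ler_wpM2l ew).
have -> : eps * w z * (d z * (p z / w z) - expR (d z) + 1) =
  p z - c z * p z - eps * w z * (expR (d z) - 1).
  by rewrite /d; field; rewrite !gt_eqF.
lra.
Qed.

Lemma sublevel_bounded L : exists2 M, 0 < M &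
  forall p, Mplus p -> obj p <= L -> forall z, 0 <= p z <= M.
Proof.
have [C HC] := obj_coercive; exists (`|L + C| + 1); first by rewrite ltr_wpDl.
move=> p p0 pL z; rewrite p0 /=.
have : p z <= \sum_z p z.
  by rewrite (bigD1 z)//= lerDl sumr_ge0.
have := HC p p0; have := ler_norm (L + C); lra.
Qed.

Definition midpoint p q : {ffun Z -> R} := [ffun z => (p z + q z) / 2].

Lemma obj_midpoint M p q : 0 < M ->
  (forall z, 0 <= p z <= M) -> (forall z, 0 <= q z <= M) ->
  obj (midpoint p q) + eps / (16 * M) * (\sum_z (p z - q z) ^+ 2)
    <= (obj p + obj q) / 2.
Proof.
move=> M0 pM qM.
have p0 : Mplus p by move=> z; case/andP: (pM z).
have q0 : Mplus q by move=> z; case/andP: (qM z).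
have Hlin : \sum_z c z * midpoint p q z
    = (\sum_z c z * p z + \sum_z c z * q z) / 2.
  rewrite -big_split mulr_suml /=; apply: eq_bigr => z _.
  by rewrite ffunE; field.
have Hkl : eps * (\sum_z w z * kl (midpoint p q z / w z))
      + eps / (16 * M) * (\sum_z (p z - q z) ^+ 2)
    <= (eps * (\sum_z w z * kl (p z / w z)) +
        eps * (\sum_z w z * kl (q z / w z))) / 2.
  rewrite -mulrDr -big_split /= !mulr_sumr -big_split mulr_suml /=.
  apply: ler_sum => z _; have wz := w_gt0 z.
  have Mw : 0 < M / w z by rewrite divr_gt0.
  have pw : 0 <= p z / w z <= M / w z.
    by rewrite ler_pM2r ?invr_gt0//; have [? ->] := andP (pM z); rewrite divr_ge0// ltW.
  have qw : 0 <= q z / w z <= M / w z.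
    by rewrite ler_pM2r ?invr_gt0//; have [? ->] := andP (qM z); rewrite divr_ge0// ltW.
  have ew : 0 <= eps * w z by rewrite mulr_ge0// ltW.
  have := ler_wpM2l ew (kl_midpoint Mw pw qw); rewrite ffunE.
  have -> : (p z / w z + q z / w z) / 2 = (p z + q z) / 2 / w z.
    by field; rewrite gt_eqF.
  have E : eps * w z * ((p z / w z - q z / w z) ^+ 2 / (16 * (M / w z))) =
    eps / (16 * M) * (p z - q z) ^+ 2.
    by field; rewrite !gt_eqF.
  rewrite mulrDr E; lra.
have Hridge : \sum_j v j * g j (lin j (midpoint p q))
    <= (\sum_j v j * g j (lin j p) + \sum_j v j * g j (lin j q)) / 2.
  rewrite -big_split mulr_suml /=; apply: ler_sum => j _.
  have -> : lin j (midpoint p q) = (lin j p + lin j q) / 2.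
    rewrite /lin -big_split mulr_suml /=; apply: eq_bigr => z _.
    by rewrite ffunE; field.
  have := ler_wpM2l (v_ge0 j)
    (regular_midpoint (g_reg j) (lin_ge0 j p0) (lin_ge0 j q0)); lra.
rewrite /obj; lra.
Qed.

(** The plans [u n] have nonnegative masses, which matters because the integrands
    are continuous on the closed half-line only. *)
Lemma obj_cvg (T : Type) (F : set_system T) (u : T -> {ffun Z -> R}) p :
  Filter F -> (forall n, Mplus (u n)) -> Mplus p ->
  (forall z, u n z @[n --> F] --> p z) -> obj (u n) @[n --> F] --> obj p.
Proof.
move=> FF u0 p0 up.
have nonneg_cvg (f : R -> R) (h : T -> R) (l : R) :
    (f s @[s --> within [set s | 0 <= s] (nbhs l)] --> f l) ->
    (forall n, 0 <= h n) -> h @ F --> l -> f (h n) @[n --> F] --> f l.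
  move=> fl h0 hl; apply: cvg_comp fl => A.
  rewrite /= withinE /= => -[B Bl AB].
  have : F (h @^-1` B) := hl _ Bl; change (F (h @^-1` B) -> F (h @^-1` A)).
  apply: filterS => n Bn.
  have : (A `&` [set s | 0 <= s]) (h n) by rewrite AB; split => //; exact: h0.
  by case.
apply: cvgD; first apply: cvgD.
- by apply: fin_cvg_sum => z; apply: cvgM; [exact: cvg_cst|exact: up].
- apply: cvgM; first exact: cvg_cst.
  apply: fin_cvg_sum => z; apply: cvgM; first exact: cvg_cst.
  apply: (nonneg_cvg _ (fun n => u n z / w z)).
  + by apply: kl_cvg; rewrite divr_ge0// ltW.
  + by move=> n; rewrite divr_ge0//; [exact: u0|rewrite ltW].
  + by apply: cvgM; [exact: up|exact: cvg_cst].
- apply: fin_cvg_sum => j; apply: cvgM; first exact: cvg_cst.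
  apply: (nonneg_cvg _ (fun n => lin j (u n))).
  + by apply: (regular_cvg (g_reg j)); exact: lin_ge0.
  + by move=> n; exact: lin_ge0.
  + by apply: fin_cvg_sum => z; apply: cvgM; [exact: cvg_cst|exact: up].
Qed.

(** Moves along one coordinate suffice for the optimality conditions: they stay
    in every block whose cell contains that coordinate. *)
Definition shift p (z0 : Z) (t : R) : {ffun Z -> R} :=
  [ffun z => if z == z0 then p z + t else p z].

Lemma sum_shift (f : Z -> R -> R) p z0 t :
  \sum_z f z (shift p z0 t z) =
  \sum_z f z (p z) + (f z0 (p z0 + t) - f z0 (p z0)).
Proof.
rewrite (bigD1 z0)//= [in RHS](bigD1 z0)//= ffunE eqxx.
rewrite (eq_bigr (fun z => f z (p z))); first lra.
by move=> z /negPf zz0; rewrite ffunE zz0.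
Qed.

Lemma lin_shift j p z0 t : lin j (shift p z0 t) = lin j p + a j z0 * t.
Proof.
rewrite /lin (sum_shift (fun z s => a j z * s)); congr (_ + _); ring.
Qed.

Lemma obj_shift p z0 t : obj (shift p z0 t) =
  obj p + c z0 * t
  + eps * w z0 * (kl ((p z0 + t) / w z0) - kl (p z0 / w z0))
  + \sum_j v j * (g j (lin j p + a j z0 * t) - g j (lin j p)).
Proof.
have -> : \sum_j v j * (g j (lin j p + a j z0 * t) - g j (lin j p)) =
    \sum_j v j * g j (lin j (shift p z0 t)) - \sum_j v j * g j (lin j p).
  rewrite -sumrB; apply: eq_bigr => j _; rewrite lin_shift; ring.
rewrite /obj (sum_shift (fun z s => c z * s)).
rewrite (sum_shift (fun z s => w z * kl (s / w z))); ring.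
Qed.

Definition block A p : set {ffun Z -> R} :=
  [set r | Mplus r /\ forall z, z \notin A -> r z = p z].

Definition block_min A p q : Prop :=
  block A p q /\ forall r, block A p r -> obj q <= obj r.

(** Adding a small mass [t] at an empty point changes the objective by at most
    [t * (c z0 + D + eps * (ln (t / w z0) - 1))], where [D] bounds the difference
    quotients of the marginal terms; this is negative for small [t]. *)
Lemma block_min_gt0 A p z0 : Mplus p -> block_min A p p -> z0 \in A ->
  0 < p z0.
Proof.
move=> p0 [_ pmin] z0A; rewrite lt_def p0 andbT; apply/eqP => pz0.
pose D := \sum_j v j * (g j (lin j p + a j z0) - g j (lin j p)).
(* For this [t] the bracket is at most [- eps]. *)
pose t := Num.min 1 (w z0 * expR (- ((c z0 + D) / eps))).
have wz := w_gt0 z0.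
have t0 : 0 < t by rewrite lt_min ltr01 mulr_gt0 ?expR_gt0.
have t1 : t <= 1 by rewrite ge_min lexx.
have t01 : 0 <= t <= 1 by rewrite ltW.
have blk : block A p (shift p z0 t).
  split=> z; first by rewrite ffunE; case: eqP => _ //; rewrite addr_ge0// ltW.
  by move=> zA; rewrite ffunE; case: eqP => // zz; rewrite zz z0A in zA.
have := pmin _ blk; rewrite obj_shift pz0 add0r mul0r.
have Hr : \sum_j v j * (g j (lin j p + a j z0 * t) - g j (lin j p)) <= t * D.
  rewrite /D mulr_sumr; apply: ler_sum => j _.
  have := ler_wpM2l (v_ge0 j)
    (regular_step (g_reg j) (lin_ge0 j p0) (a_ge0 j z0) t01).
  rewrite (mulrC (a j z0)); lra.
have Hln : ln (t / w z0) <= - ((c z0 + D) / eps).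
  rewrite -[leRHS]expRK ler_ln ?posrE ?divr_gt0 ?expR_gt0//.
  by rewrite ler_pdivrMr// mulrC ge_min lexx orbT.
have -> : eps * w z0 * (kl (t / w z0) - kl 0) = t * (eps * (ln (t / w z0) - 1)).
  by rewrite /kl mul0r; field; rewrite gt_eqF.
have : eps * (ln (t / w z0) - 1) <= - (c z0 + D) - eps.
  have -> : - (c z0 + D) - eps = eps * (- ((c z0 + D) / eps) - 1).
    by field; rewrite gt_eqF.
  by rewrite ler_pM2l// lerB.
move=> /(ler_wpM2l (ltW t0)) H1 H2.
have : 0 < t * eps by rewrite mulr_gt0.
nra.
Qed.

Definition obj_grad p (z : Z) : R :=
  c z + eps * ln (p z / w z) + \sum_j v j * ('D_1 (g j) (lin j p) * a j z).

(** At a positive plan all the linear forms are positive, hence the functions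
    [g j] are differentiable there. *)
Lemma is_derive_obj_shift p z0 t : (forall z, 0 < shift p z0 t z) ->
  is_derive t 1 (fun s => obj (shift p z0 s)) (obj_grad (shift p z0 t) z0).
Proof.
move=> pt0.
have -> : (fun s => obj (shift p z0 s)) = (fun s =>
  obj p + c z0 * s
  + eps * w z0 * (kl (p z0 / w z0 + (w z0)^-1 * s) - kl (p z0 / w z0))
  + \sum_j v j * (g j (lin j p + a j z0 * s) - g j (lin j p))).
  apply/funext => s; rewrite obj_shift mulrDl.
  by rewrite [s / _]mulrC.
have pzt : 0 < p z0 + t by have := pt0 z0; rewrite ffunE eqxx.
have dlin : is_derive t 1 (fun s : R => obj p + c z0 * s) (c z0).
  have := @is_derive_affine_comp R id (obj p) (c z0) t 1
    (is_derive_id (obj p + c z0 * t) (1 : R)).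
  by rewrite mul1r.
have dkl : is_derive t 1 (fun s => kl (p z0 / w z0 + (w z0)^-1 * s))
    (ln (shift p z0 t z0 / w z0) * (w z0)^-1).
  apply: is_derive_affine_comp; rewrite ffunE eqxx mulrDl [t / _]mulrC.
  by apply: is_derive_kl; rewrite [_ * t]mulrC -mulrDl divr_gt0.
have dg j : is_derive t 1 (fun s => g j (lin j p + a j z0 * s))
    ('D_1 (g j) (lin j (shift p z0 t)) * a j z0).
  apply: is_derive_affine_comp; rewrite lin_shift; apply: derivableP.
  by apply: (regular_derivable (g_reg j)); rewrite -lin_shift lin_gt0.
have dgs := is_derive_fsum (fun j =>
  is_deriveM (is_derive_cst (v j) t (1 : R))
    (is_deriveB (dg j) (is_derive_cst (g j (lin j p)) t (1 : R)))).
have := is_deriveD (is_deriveD dlin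
  (is_deriveM (is_derive_cst (eps * w z0) t (1 : R))
    (is_deriveB dkl (is_derive_cst (kl (p z0 / w z0)) t (1 : R))))) dgs.
set d := (X in is_derive _ _ _ X -> _).
suff -> : d = obj_grad (shift p z0 t) z0 by [].
rewrite /d /obj_grad /GRing.scale /= !mulr0 !addr0; congr (_ + _ + _).
  by rewrite subr0; field; rewrite gt_eqF.
by apply: eq_bigr => j _; rewrite subr0 mulr0 addr0.
Qed.

Lemma block_min_grad0 A p z0 : (forall z, 0 < p z) -> block_min A p p ->
  z0 \in A -> obj_grad p z0 = 0.
Proof.
move=> p0 [_ pmin] z0A.
have pos t : - p z0 < t -> forall z, 0 < shift p z0 t z.
  move=> tp z; rewrite ffunE; case: eqP => // ->; lra.
have shift0 : shift p z0 0 = p.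
  by apply/ffunP => z; rewrite ffunE addr0 if_same.
have pz0 := p0 z0.
have H : is_derive (0 : R) 1 (fun s => obj (shift p z0 s)) 0.
  apply: (@derive1_at_min _ _ (- p z0) (p z0)).
  - lra.
  - move=> t; rewrite in_itv /= => /andP[tp _].
    by have [] := is_derive_obj_shift (pos t tp).
  - by rewrite in_itv /=; lra.
  - move=> t; rewrite in_itv /= => /andP[tp _]; rewrite shift0; apply: pmin.
    split=> z; first exact/ltW/pos.
    by move=> zA; rewrite ffunE; case: eqP => // zz; rewrite zz z0A in zA.
have H' : is_derive (0 : R) 1 (fun s => obj (shift p z0 s)) (obj_grad p z0).
  have := @is_derive_obj_shift p z0 0; rewrite shift0; exact.
by have [_ <-] := H'; have [_ ->] := H.
Qed.

Lemma obj_tangent p q : (forall z, 0 < p z) -> Mplus q ->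
  obj p + \sum_z obj_grad p z * (q z - p z) <= obj q.
Proof.
move=> p0 q0.
have -> : \sum_z obj_grad p z * (q z - p z) =
  (\sum_z c z * q z - \sum_z c z * p z)
  + eps * (\sum_z ln (p z / w z) * (q z - p z))
  + \sum_j v j * ('D_1 (g j) (lin j p) * (lin j q - lin j p)).
  have -> : \sum_j v j * ('D_1 (g j) (lin j p) * (lin j q - lin j p)) =
      \sum_z (\sum_j v j * ('D_1 (g j) (lin j p) * a j z)) * (q z - p z).
    under [RHS]eq_bigr do rewrite mulr_suml.
    rewrite exchange_big /=; apply: eq_bigr => j _.
    rewrite /lin -sumrB !mulr_sumr; apply: eq_bigr => z _; ring.
  rewrite -sumrB mulr_sumr -!big_split /=; apply: eq_bigr => z _.
  rewrite /obj_grad; ring.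
have Hkl : eps * (\sum_z w z * kl (p z / w z)) +
    eps * (\sum_z ln (p z / w z) * (q z - p z)) <=
    eps * (\sum_z w z * kl (q z / w z)).
  rewrite -mulrDr ler_pM2l// -big_split /=; apply: ler_sum => z _.
  have wz := w_gt0 z.
  have pw : 0 < p z / w z by rewrite divr_gt0.
  have qw : 0 <= q z / w z by rewrite divr_ge0// ltW.
  have := ler_wpM2l (ltW wz) (kl_tangent pw qw); rewrite mulrDr.
  have -> : w z * (ln (p z / w z) * (q z / w z - p z / w z)) =
    ln (p z / w z) * (q z - p z) by field; rewrite gt_eqF.
  by [].
have Hr : \sum_j v j * g j (lin j p) +
    \sum_j v j * ('D_1 (g j) (lin j p) * (lin j q - lin j p)) <=
    \sum_j v j * g j (lin j q).
  rewrite -big_split /=; apply: ler_sum => j _.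
  have := ler_wpM2l (v_ge0 j)
    (regular_tangent (g_reg j) (lin_gt0 j p0) (lin_ge0 j q0)).
  by rewrite mulrDr.
rewrite /obj; lra.
Qed.

(** Block minimality makes the gradient vanish, and the tangent inequality then
    compares the plan with every other one. *)
Lemma blockwise_min_global p : Mplus p ->
  (forall z, exists2 A : {set Z}, z \in A & block_min A p p) ->
  forall q, Mplus q -> obj p <= obj q.
Proof.
move=> p0 pmin q q0.
have pp z : 0 < p z by have [A zA /block_min_gt0] := pmin z; apply.
apply: le_trans (obj_tangent pp q0); rewrite big1 ?addr0// => z _.
by have [A zA Amin] := pmin z; rewrite (block_min_grad0 pp Amin zA) mul0r.
Qed.

(** * Existence and stability of block minimizers *)

Lemma Mplus_limit (T : Type) (F : set_system T) (u : T -> {ffun Z -> R}) p :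
  ProperFilter F -> (forall n, Mplus (u n)) ->
  (forall z, u n z @[n --> F] --> p z) -> Mplus p.
Proof.
move=> FF u0 up z; apply: (cvgr_to_ge (up z)).
by apply: filterE => n; exact: u0.
Qed.

Lemma ultra_limit (U : set_system nat) (u : nat -> {ffun Z -> R}) M :
  UltraFilter U -> (forall n z, 0 <= u n z <= M) ->
  exists p : {ffun Z -> R}, forall z, u n z @[n --> U] --> p z.
Proof.
move=> UU uM.
have /choice[l ul] z : exists l : R, u n z @[n --> U] --> l.
  exact: (ultra_bounded_cvg UU (fun n => uM n z)).
by exists (finfun l) => z; rewrite ffunE.
Qed.

(** The direct method: a minimizing sequence is bounded by coercivity, and its
    limit along an ultrafilter attains the infimum by continuity. *)
Lemma block_minimizer A p : Mplus p -> exists q, block_min A p q.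
Proof.
move=> p0; pose E := [set obj r | r in block A p].
have [C HC] := obj_coercive.
have Einf : has_inf E.
  split; first by exists (obj p), p.
  exists (- C) => _ [r [r0 _] <-]; have := HC r r0.
  have : 0 <= \sum_z r z by apply: sumr_ge0.
  lra.
have /choice[u Hu] (n : nat) : exists r, block A p r /\ obj r < inf E + n.+1%:R^-1.
  have n0 : (0 : R) < n.+1%:R^-1 by rewrite invr_gt0.
  by have [_ [r rb <-] rlt] := inf_adherent n0 Einf; exists r.
have u0 n : Mplus (u n) by have [[]] := Hu n.
have [U [UU subU]] := ultraFilterLemma (eventually_filter : ProperFilter \oo).
have PU : ProperFilter U by exact: ultra_proper.
have [M M0 HM] := sublevel_bounded (inf E + 1).
have uM n z : 0 <= u n z <= M.
  apply: HM => //; have [_ /ltW/le_trans] := Hu n; apply.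
  by rewrite lerD2l invf_le1// ler1n.
have [q uq] := ultra_limit UU uM.
have q0 : Mplus q := Mplus_limit PU u0 uq.
exists q; split.
  split; first exact: q0.
  move=> z zA; apply: (cvg_unique _ (uq z)) => //.
  have -> : (fun n => u n z) = fun=> p z.
    by apply/funext => n; have [[_ ->]] := Hu n.
  exact: cvg_cst.
move=> r rb; apply: (@le_trans _ _ (inf E)); last first.
  by apply: ge_inf; [exact: Einf.2|exists r].
have ocvg : obj (u n) @[n --> U] --> obj q := obj_cvg PU u0 q0 uq.
have icvg : inf E + n.+1%:R^-1 @[n --> U] --> inf E + 0.
  apply: cvgD; first exact: cvg_cst.
  by apply: cvg_trans (@cvg_harmonic R); exact: cvg_app.
rewrite -[leRHS]addr0; apply: (ler_cvg_to ocvg icvg).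
by apply: filterE => n; have [_ /ltW] := Hu n.
Qed.

(** Compare the minimizer with its midpoint with [p], which is in the same
    block. *)
Lemma block_min_descent M A p q : 0 < M ->
  (forall z, 0 <= p z <= M) -> (forall z, 0 <= q z <= M) ->
  block_min A p q ->
  obj q + eps / (8 * M) * (\sum_z (p z - q z) ^+ 2) <= obj p.
Proof.
move=> M0 pM qM [[_ qA] qmin].
have mid : block A p (midpoint p q).
  split=> z; rewrite ffunE.
    by have := pM z; have := qM z; lra.
  by move=> /qA ->; field.
have := le_trans (lerD (qmin _ mid) (lexx _)) (obj_midpoint M0 pM qM).
have -> : eps / (8 * M) = 2 * (eps / (16 * M)) by field; rewrite gt_eqF.
lra.
Qed.

Lemma cvg_of_sqr_le (T : Type) (F : set_system T) (f d : T -> R) (l : R) :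
  Filter F -> (forall n, (f n - l) ^+ 2 <= d n) -> d @ F --> (0 : R) ->
  f @ F --> l.
Proof.
move=> FF fd d0; apply/cvgrPdist_lt => e e0.
have e2 : 0 < e ^+ 2 by rewrite exprn_gt0.
near=> n; have dn : d n < e ^+ 2 by near: n; exact: cvgr_lt d0 _ e2.
rewrite distrC -(@ltr_pXn2r _ 2)// ?nnegrE ?ltW//.
by rewrite real_normK ?num_real// (le_lt_trans (fd n)).
Unshelve. all: by end_near. Qed.

(** Steps are controlled by the decrease of the objective, so the updated plans
    have the same limit.  A competitor of the limit is the limit of competitors
    of the plans [u n], obtained by restoring the values of [u n] off the
    block; minimality passes to the limit by continuity. *)
Lemma block_min_limit (T : Type) (F : set_system T) (u q : T -> {ffun Z -> R})
    A p M : ProperFilter F -> 0 < M ->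
  (forall n z, 0 <= u n z <= M) -> (forall n z, 0 <= q n z <= M) ->
  (forall n, block_min A (u n) (q n)) ->
  (forall z, u n z @[n --> F] --> p z) ->
  obj (u n) - obj (q n) @[n --> F] --> (0 : R) ->
  (forall z, q n z @[n --> F] --> p z) /\ block_min A p p.
Proof.
move=> FF M0 uM qM umin up du.
have u0 n : Mplus (u n) by move=> z; case/andP: (uM n z).
have q0 n : Mplus (q n) by move=> z; case/andP: (qM n z).
have p0 : Mplus p := Mplus_limit FF u0 up.
have qp z : q n z @[n --> F] --> p z.
  have dq : q n z - u n z @[n --> F] --> (0 : R).
    apply: (@cvg_of_sqr_le _ _ _
      (fun n => (eps / (8 * M))^-1 * (obj (u n) - obj (q n)))).
      move=> n; rewrite subr0 ler_pdivlMl ?divr_gt0 ?mulr_gt0//.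
      have := block_min_descent M0 (uM n) (qM n) (umin n).
      rewrite lerBrDl; apply: le_trans; rewrite lerD2l ler_pM2l; last first.
        by rewrite divr_gt0 ?mulr_gt0.
      rewrite -sqrrN opprB [leRHS](bigD1 z)//= lerDl.
      by apply: sumr_ge0 => y _; exact: sqr_ge0.
    by rewrite -[X in _ --> X](mulr0 (eps / (8 * M))^-1); apply: cvgM => //; exact: cvg_cst.
  have -> : (fun n => q n z) = (fun n => (q n z - u n z) + u n z).
    by apply/funext => n; rewrite subrK.
  by rewrite -[p z]add0r; apply: cvgD.
split=> //; split=> // r [r0 rA].
pose v' n : {ffun Z -> R} := [ffun z => if z \in A then r z else u n z].
have v'0 n : Mplus (v' n).
  by move=> z; rewrite ffunE; case: ifP => _; [exact: r0|exact: u0].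
have v'r z : v' n z @[n --> F] --> r z.
  have [zA|zA] := boolP (z \in A).
    under eq_cvg do rewrite ffunE zA; exact: cvg_cst.
  under eq_cvg do rewrite ffunE (negPf zA).
  by rewrite rA//; exact: up.
have oq : obj (q n) @[n --> F] --> obj p := obj_cvg FF q0 p0 qp.
have ov : obj (v' n) @[n --> F] --> obj r := obj_cvg FF v'0 r0 v'r.
have ovq : obj (v' n) - obj (q n) @[n --> F] --> obj r - obj p by exact: cvgB.
rewrite -subr_ge0; apply: (cvgr_to_ge ovq); apply: filterE => n.
rewrite subr_ge0; have [_] := umin n; apply; split=> // z zA.
by rewrite ffunE (negPf zA).
Qed.

(** * Convergence of successive block minimizations *)

Section Sweeps.
Variables (B : eqType) (dom_of : B -> {set Z}).
Variable upd : {ffun Z -> R} -> B -> {ffun Z -> R}.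
Hypothesis updP : forall p b, Mplus p -> block_min (dom_of b) p (upd p b).

Lemma upd_descent p b : Mplus p -> Mplus (upd p b) /\ obj (upd p b) <= obj p.
Proof.
move=> p0; have [[q0 _] qmin] := updP b p0; split=> //.
by apply: qmin; split.
Qed.

Lemma foldl_upd_descent (s : seq B) p : Mplus p ->
  Mplus (foldl upd p s) /\ obj (foldl upd p s) <= obj p.
Proof.
elim: s p => [|b s IH] p p0 //=; have [q0 qp] := upd_descent b p0.
by have [s0 sq] := IH _ q0; split; last exact: le_trans sq qp.
Qed.

(** The decrease over the sweep bounds the decrease of each of its updates, so
    [block_min_limit] applies to the updates one after the other, each one
    having the same limit as the one before. *)
Lemma sweep_limit_block_min (T : Type) (F : set_system T) (s : seq B)
    (u : T -> {ffun Z -> R}) p L : ProperFilter F ->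
  (forall n, Mplus (u n)) -> (forall n, obj (u n) <= L) ->
  (forall z, u n z @[n --> F] --> p z) ->
  obj (u n) - obj (foldl upd (u n) s) @[n --> F] --> (0 : R) ->
  forall b, b \in s -> block_min (dom_of b) p p.
Proof.
move=> FF; elim: s u => [//|b s IH] u u0 uL up /= du.
have [M M0 HM] := sublevel_bounded L.
pose q n := upd (u n) b.
have q0 n : Mplus (q n) by have [] := upd_descent b (u0 n).
have qu n : obj (q n) <= obj (u n) by have [] := upd_descent b (u0 n).
have sq n : obj (foldl upd (q n) s) <= obj (q n).
  by have [] := foldl_upd_descent s (q0 n).
have qL n : obj (q n) <= L := le_trans (qu n) (uL n).
have duq : obj (u n) - obj (q n) @[n --> F] --> (0 : R).
  apply: (squeeze_cvgr _ (cvg_cst 0) du); apply: filterE => n.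
  by rewrite subr_ge0 qu /= lerD2l lerN2 sq.
have dqs : obj (q n) - obj (foldl upd (q n) s) @[n --> F] --> (0 : R).
  apply: (squeeze_cvgr _ (cvg_cst 0) du); apply: filterE => n.
  by rewrite subr_ge0 sq /= lerD2r qu.
have [qp bmin] : (forall z, q n z @[n --> F] --> p z) /\ block_min (dom_of b) p p.
  apply: (block_min_limit FF M0 _ _ _ up duq).
  - by move=> n; exact: HM.
  - by move=> n; exact: HM.
  - by move=> n; exact: updP.
move=> b'; rewrite inE => /predU1P[-> //|]; exact: (IH q).
Qed.

(** The steps between two sweeps of [s] can only decrease the objective, so the
    decrease over the sweeps of [s] tends to zero and [sweep_limit_block_min]
    applies to the iterates that precede them.  The minimizer is found as a limit point of the iterates, and
    [block_min_descent] for the block of all points gives both its uniqueness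
    and the convergence of the iterates. *)
Lemma cyclic_sweeps_converge (s : seq B) (o : nat -> seq B)
    (x : nat -> {ffun Z -> R}) :
  (forall z, exists2 b, b \in s & z \in dom_of b) ->
  (forall n, o n.*2 = s) ->
  Mplus (x 0%N) -> (forall k, x k.+1 = foldl upd (x k) (o k)) ->
  exists p, [/\ Mplus p, forall q, Mplus q -> obj p <= obj q,
    forall q, Mplus q -> obj q <= obj p -> q = p &
    forall z, x k z @[k --> \oo] --> p z].
Proof.
move=> cover os x00 xS.
have x0 k : Mplus (x k).
  by elim: k => // k IH; rewrite xS; have [] := foldl_upd_descent (o k) IH.
have xdec k : obj (x k.+1) <= obj (x k).
  by rewrite xS; have [] := foldl_upd_descent (o k) (x0 k).
have xL k : obj (x k) <= obj (x 0%N).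
  by elim: k => // k /(le_trans (xdec k)).
have [M M0 HM] := sublevel_bounded (obj (x 0%N)).
have [C HC] := obj_coercive.
have [L oL] : exists L : R, obj (x k) @[k --> \oo] --> L.
  eexists; apply: nonincreasing_cvgn.
    by apply/nonincreasing_seqP.
  exists (- C) => _ [k _ <-]; have := HC _ (x0 k).
  have : 0 <= \sum_z x k z by apply: sumr_ge0 => z _; exact: x0.
  lra.
have [U [UU subU]] := ultraFilterLemma (eventually_filter : ProperFilter \oo).
have PU : ProperFilter U by exact: ultra_proper.
have oLsub (f : nat -> nat) : (forall n, (n <= f n)%N) ->
    obj (x (f n)) @[n --> U] --> L.
  move=> fn A /oL[N _ NA]; apply: subU; exists N => // n /= Nn; apply: NA => /=.
  exact: leq_trans (fn n).
have oL2 : obj (x n.*2) @[n --> U] --> L.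
  by apply: oLsub => n; rewrite -addnn leq_addr.
have oL2S : obj (x n.*2.+1) @[n --> U] --> L.
  by apply: (oLsub (fun n => n.*2.+1)) => n; rewrite leqW// -addnn leq_addr.
have xM k z : 0 <= x k z <= M by exact: HM.
have [p xp] := ultra_limit UU (fun n => xM n.*2).
have p0 : Mplus p := Mplus_limit PU (fun n => x0 n.*2) xp.
have pmin q : Mplus q -> obj p <= obj q.
  apply: blockwise_min_global => // z; have [b bs zb] := cover z.
  exists (dom_of b) => //.
  apply: (sweep_limit_block_min PU (fun n => x0 n.*2) (fun n => xL n.*2) xp _ bs).
  rewrite -(subrr L); apply: cvgB => //.
  have -> : (fun n => obj (foldl upd (x n.*2) s)) = fun n => obj (x n.*2.+1).
    by apply/funext => n; rewrite xS os.
  exact: oL2S.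
have pLE : L = obj p.
  apply: (cvg_unique _ oL2) => //.
  exact: (obj_cvg PU (fun n => x0 n.*2) p0 xp).
(* A global minimizer is minimal in the block of all points around any plan. *)
have bmin q : Mplus q -> block_min [set: Z]%SET q p.
  by move=> q0; split; [split=> // z; rewrite inE|move=> r [r0 _]; exact: pmin].
exists p; split=> //.
- move=> q q0 qp.
  have [N N0 HN] := sublevel_bounded (obj p).
  have := block_min_descent N0 (HN _ q0 qp) (HN _ p0 (lexx _)) (bmin q q0).
  move=> /le_trans/(_ qp); rewrite gerDl pmulr_rle0 ?divr_gt0 ?mulr_gt0// => H.
  have /eqP : \sum_z (q z - p z) ^+ 2 = 0.
    by apply/eqP; rewrite eq_le H sumr_ge0// => z _; exact: sqr_ge0.
  rewrite psumr_eq0; last by move=> z _; exact: sqr_ge0.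
  move=> /allP H'; apply/ffunP => z; apply/eqP.
  by have := H' z (mem_index_enum z); rewrite /= sqrf_eq0 subr_eq0.
- move=> z; apply: (@cvg_of_sqr_le _ _ _
    (fun k => (eps / (8 * M))^-1 * (obj (x k) - obj p))).
    move=> k; rewrite ler_pdivlMl ?divr_gt0 ?mulr_gt0//.
    have pM := HM p p0 (pmin _ (x0 0%N)).
    have := block_min_descent M0 (xM k) pM (bmin _ (x0 k)).
    rewrite lerBrDl; apply: le_trans; rewrite lerD2l ler_pM2l; last first.
      by rewrite divr_gt0 ?mulr_gt0.
    rewrite [leRHS](bigD1 z)//= lerDl.
    by apply: sumr_ge0 => y _; exact: sqr_ge0.
  rewrite -(mulr0 (eps / (8 * M))^-1) -(subrr L) {2}pLE.
  by apply: cvgM; [exact: cvg_cst|apply: cvgB => //; exact: cvg_cst].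
Qed.

End Sweeps.

End RegularizedObjective.

(** * Unbalanced transport as a regularized objective *)

Section RealValued.
Variables (R : realType) (Z : finType).
Implicit Types (rho sigma : {ffun Z -> R}) (A : {set Z}).

Lemma divergence_fin (phi : R -> \bar R) rho sigma :
  (forall t, (0 <= phi t)%E) -> (forall t, 0 <= t -> (phi t < +oo)%E) ->
  Mplus rho -> Mplus sigma -> (forall z, sigma z = 0 -> rho z = 0) ->
  divergence phi rho sigma =
    (\sum_z sigma z * (fine \o phi) (rho z / sigma z))%:E.
Proof.
move=> ge0 fin rho0 sigma0 ac.
have sing0 : mass (sing rho sigma) [set: Z]%SET = 0.
  by apply: big1 => z _; rewrite ffunE; case: eqP => // /ac.
rewrite /divergence sing0 mule0 adde0 -sumEFin; apply: eq_bigr => z _.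
rewrite /dens muleC EFinM /= fineK// ge0_fin_numE// fin// divr_ge0//.
Qed.

Lemma KL_fin rho sigma : (forall z, sigma z = 0 -> rho z = 0) ->
  KL rho sigma = (\sum_z sigma z * kl (rho z / sigma z))%:E.
Proof.
move=> ac; rewrite /KL ifT; last first.
  by apply/forallP => z; apply/implyP => /eqP/ac/eqP.
by congr (_%:E); apply: eq_bigr => z _; rewrite mulrC.
Qed.

Lemma sum_restr sigma A (f : R -> R) rho :
  \sum_z restr sigma A z * f (rho z / restr sigma A z) =
  \sum_(z in A) sigma z * f (rho z / sigma z).
Proof.
rewrite [RHS]big_mkcond /=; apply: eq_bigr => z _.
by rewrite ffunE; case: ifP => // _; rewrite mul0r.
Qed.

End RealValued.

Section Bridge.
Variables (R : realType) (X Y : finType).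
Variables (mu : {ffun X -> R}) (nu : {ffun Y -> R}).
Hypotheses (mu_full : forall x, 0 < mu x) (nu_full : forall y, 0 < nu y).
Variables (c : X * Y -> R) (eps : R).
Hypothesis eps_gt0 : 0 < eps.
Variables phi1 phi2 : R -> \bar R.
Hypotheses (phi1_ge0 : forall t, (0 <= phi1 t)%E)
  (phi2_ge0 : forall t, (0 <= phi2 t)%E)
  (phi1_fin : forall t : R, 0 <= t -> (phi1 t < +oo)%E)
  (phi2_fin : forall t : R, 0 <= t -> (phi2 t < +oo)%E).
Implicit Types p q : {ffun X * Y -> R}.

Definition marg_weight (j : X + Y) : R :=
  match j with inl x => mu x | inr y => nu y end.

Definition marg_coef (j : X + Y) (z : X * Y) : R :=
  match j with
  | inl x => (z.1 == x)%:R / mu x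
  | inr y => (z.2 == y)%:R / nu y
  end.

Definition marg_entropy (j : X + Y) : R -> R :=
  match j with inl _ => fine \o phi1 | inr _ => fine \o phi2 end.

Definition uot : {ffun X * Y -> R} -> R :=
  obj c eps (prod_meas mu nu) marg_weight marg_coef marg_entropy.

Lemma PX_ge0 p : Mplus p -> Mplus (PX p).
Proof. by move=> p0 x; rewrite ffunE sumr_ge0. Qed.

Lemma PY_ge0 p : Mplus p -> Mplus (PY p).
Proof. by move=> p0 y; rewrite ffunE sumr_ge0. Qed.

Lemma prod_meas_gt0 z : 0 < prod_meas mu nu z.
Proof. by rewrite ffunE mulr_gt0. Qed.

Lemma lin_PX p x : lin marg_coef (inl x) p = PX p x / mu x.
Proof.
rewrite /lin ffunE mulr_suml /=.
transitivity (\sum_x' \sum_y (x' == x)%:R / mu x * p (x', y)).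
  by rewrite pair_bigA; apply: eq_bigr => -[].
rewrite (bigD1 x)//= [X in _ + X]big1 ?addr0; last first.
  by move=> x' /negPf x'x; apply: big1 => y _; rewrite x'x !mul0r.
by apply: eq_bigr => y _; rewrite eqxx /= mulr1n; ring.
Qed.

Lemma lin_PY p y : lin marg_coef (inr y) p = PY p y / nu y.
Proof.
rewrite /lin ffunE mulr_suml /=.
transitivity (\sum_x \sum_y' (y' == y)%:R / nu y * p (x, y')).
  by rewrite pair_bigA; apply: eq_bigr => -[].
apply: eq_bigr => x _; rewrite (bigD1 y)//= [X in _ + X]big1 ?addr0; last first.
  by move=> y' /negPf y'y; rewrite y'y !mul0r.
by rewrite eqxx /= mulr1n; ring.
Qed.

Lemma uotE p : uot p =
  pairing c p
  + eps * (\sum_z prod_meas mu nu z * kl (p z / prod_meas mu nu z))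
  + \sum_x mu x * (fine \o phi1) (PX p x / mu x)
  + \sum_y nu y * (fine \o phi2) (PY p y / nu y).
Proof.
rewrite /uot /obj big_sumType /= !addrA; congr (_ + _ + _ + _).
  by apply: eq_bigr => x _; rewrite lin_PX.
by apply: eq_bigr => y _; rewrite lin_PY.
Qed.

Lemma E_glob_uot p : Mplus p -> E_glob c eps phi1 phi2 mu nu p = (uot p)%:E.
Proof.
move=> p0; rewrite /E_glob KL_fin; last first.
  by move=> z zE; have := prod_meas_gt0 z; rewrite zE ltxx.
rewrite (divergence_fin phi1_ge0 phi1_fin); first last.
- by move=> x xE; have := mu_full x; rewrite xE ltxx.
- by move=> x; exact: ltW.
- exact: PX_ge0.
rewrite (divergence_fin phi2_ge0 phi2_fin); first last.
- by move=> y yE; have := nu_full y; rewrite yE ltxx.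
- by move=> y; exact: ltW.
- exact: PY_ge0.
by rewrite uotE.
Qed.

Variables (I : finType) (Xs : I -> {set X}).
Implicit Type J : {set I}.

Lemma in_cellY J z : (z \in cellY Y Xs J) = (z.1 \in cell Xs J).
Proof. by rewrite !inE andbT. Qed.

Lemma prod_meas_restr J : prod_meas (restr mu (cell Xs J)) nu =
  restr (prod_meas mu nu) (cellY Y Xs J).
Proof.
by apply/ffunP => z; rewrite !ffunE in_cellY; case: ifP => _; rewrite ?mul0r.
Qed.

(** The plan of a cell update: [q] on the cell and [p] elsewhere, written as the
    algorithm writes it. *)
Definition glue J p q : {ffun X * Y -> R} := p - restr p (cellY Y Xs J) + q.

Lemma glueE J p q z : Mplus_on (cellY Y Xs J) q ->
  glue J p q z = if z \in cellY Y Xs J then q z else p z.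
Proof.
move=> [_ qJ]; rewrite !ffunE; case: ifP => [_|/negbT/qJ ->].
  by rewrite subrr add0r.
by rewrite subr0 addr0.
Qed.

Lemma PX_glue J p q x : Mplus_on (cellY Y Xs J) q ->
  PX (glue J p q) x = if x \in cell Xs J then PX q x else PX p x.
Proof.
move=> qJ; rewrite !ffunE; case: ifP => xJ; apply: eq_bigr => y _;
  by rewrite (glueE _ _ qJ) in_cellY xJ.
Qed.

Lemma PY_glue J p q : PY (glue J p q) = PY q + PY (p - restr p (cellY Y Xs J)).
Proof.
apply/ffunP => y; rewrite !ffunE -big_split /=; apply: eq_bigr => x _.
by rewrite !ffunE addrC.
Qed.

(** The terms of the global objective that belong to points outside the cell do
    not involve [q]; [K] is their sum.  The second marginal is not local to the
    cell, which is why [nu_{-J}] enters the cell objective. *)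
Lemma E_cell_uot J p : Mplus p -> exists K : R, forall q,
  Mplus_on (cellY Y Xs J) q ->
  E_cell c eps phi1 phi2 mu nu Xs J (PY (p - restr p (cellY Y Xs J))) q =
    (uot (glue J p q) - K)%:E.
Proof.
move=> p0; set A := cellY Y Xs J; set w := prod_meas mu nu.
exists (\sum_(z | z \notin A) c z * p z
  + eps * (\sum_(z | z \notin A) w z * kl (p z / w z))
  + \sum_(x | x \notin cell Xs J) mu x * (fine \o phi1) (PX p x / mu x)).
move=> q qA; have [q0 qA0] := qA.
have glue_ge0 : Mplus (glue J p q).
  by move=> z; rewrite glueE//; case: ifP => _; [exact: q0|exact: p0].
rewrite /E_cell prod_meas_restr KL_fin; last first.
  move=> z; rewrite ffunE; case: ifP => [_ zE|/negbT/qA0//].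
  by have := prod_meas_gt0 z; rewrite zE ltxx.
rewrite sum_restr (divergence_fin phi1_ge0 phi1_fin); first last.
- move=> x; rewrite ffunE; case: ifP => [_ xE|xJ _].
    by have := mu_full x; rewrite xE ltxx.
  by rewrite ffunE big1// => y _; rewrite qA0// in_cellY xJ.
- by move=> x; rewrite ffunE; case: ifP => // _; exact: ltW.
- exact: PX_ge0.
rewrite sum_restr -PY_glue (divergence_fin phi2_ge0 phi2_fin); first last.
- by move=> y yE; have := nu_full y; rewrite yE ltxx.
- by move=> y; exact: ltW.
- exact: PY_ge0.
rewrite -EFinM -!EFinD uotE; congr (_%:E).
have -> : pairing c (glue J p q) =
    pairing c q + \sum_(z | z \notin A) c z * p z.
  rewrite /pairing (bigID (mem A)) /= [in RHS](bigID (mem A)) /=.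
  rewrite [X in _ = _ + X + _]big1 ?addr0; last first.
    by move=> z /qA0 ->; rewrite mulr0.
  congr (_ + _); apply: eq_bigr => z zA; rewrite glueE//.
    by rewrite zA.
  by rewrite (negPf zA).
have -> : \sum_z w z * kl (glue J p q z / w z) =
    \sum_(z in A) w z * kl (q z / w z)
    + \sum_(z | z \notin A) w z * kl (p z / w z).
  rewrite (bigID (mem A)) /=; congr (_ + _); apply: eq_bigr => z zA.
    by rewrite glueE// zA.
  by rewrite glueE// (negPf zA).
have -> : \sum_x mu x * (fine \o phi1) (PX (glue J p q) x / mu x) =
    \sum_(x in cell Xs J) mu x * (fine \o phi1) (PX q x / mu x)
    + \sum_(x | x \notin cell Xs J) mu x * (fine \o phi1) (PX p x / mu x).
  rewrite (bigID (mem (cell Xs J))) /=; congr (_ + _); apply: eq_bigr => x xJ.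
    by rewrite PX_glue// xJ.
  by rewrite PX_glue// (negPf xJ).
ring.
Qed.

Hypotheses (phi1_reg : regular_entropy (fine \o phi1))
  (phi2_reg : regular_entropy (fine \o phi2)).

Lemma marg_weight_ge0 j : 0 <= marg_weight j.
Proof. by case: j => ? /=; exact: ltW. Qed.

Lemma marg_coef_ge0 j z : 0 <= marg_coef j z.
Proof. by case: j => ? /=; rewrite divr_ge0// ltW. Qed.

Lemma marg_entropy_regular j : regular_entropy (marg_entropy j).
Proof. by case: j. Qed.

Lemma marg_coef_row (z0 : X * Y) j : exists z, 0 < marg_coef j z.
Proof.
by case: j => [x|y]; [exists (x, z0.2)|exists (z0.1, y)];
  rewrite /= eqxx divr_gt0.
Qed.

(** By [E_cell_uot], gluing turns minimizers of the cell objective into block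
    minimizers.  One exists, so [xget] does return a minimizer. *)
Lemma cell_update_block_min J p : Mplus p ->
  block_min c eps (prod_meas mu nu) marg_weight marg_coef marg_entropy
    (cellY Y Xs J) p (cell_update c eps phi1 phi2 mu nu Xs p J).
Proof.
move=> p0; set A := cellY Y Xs J.
have [K HK] := E_cell_uot J p0.
have restr_on (r : {ffun X * Y -> R}) : Mplus r -> Mplus_on A (restr r A).
  move=> r0; split=> z; rewrite ffunE; first by case: ifP => _; rewrite ?r0.
  by move=> /negPf ->.
have glue_restr r : block A p r -> glue J p (restr r A) = r.
  move=> [r0 rA]; apply/ffunP => z; rewrite (glueE _ _ (restr_on r r0)) ffunE.
  by have [//|/rA ->] := boolP (z \in A).
have glue_block q : Mplus_on A q -> block A p (glue J p q).
  move=> qA; split=> z; rewrite (glueE _ _ qA).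
    by case: ifP => _; [exact: qA.1|exact: p0].
  by move=> /negPf ->.
have [r [rA rmin]] := block_minimizer c eps_gt0 prod_meas_gt0 marg_weight_ge0
  marg_coef_ge0 marg_entropy_regular A p0.
pose nuJ := PY (p - restr p A).
have ex : is_minimizer (Mplus_on A) (E_cell c eps phi1 phi2 mu nu Xs J nuJ)
    (restr r A).
  split; first exact: restr_on rA.1.
  move=> q qA; rewrite !HK//; last exact: restr_on rA.1.
  by rewrite lee_fin lerD2r glue_restr//; apply: rmin; exact: glue_block.
have [mA mmin] : is_minimizer (Mplus_on A)
    (E_cell c eps phi1 phi2 mu nu Xs J nuJ)
    (argmin_cell c eps phi1 phi2 mu nu Xs J nuJ).
  exact: (xgetPex 0 (ex_intro _ _ ex)).
have -> : cell_update c eps phi1 phi2 mu nu Xs p J =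
  glue J p (argmin_cell c eps phi1 phi2 mu nu Xs J nuJ) by [].
split; first exact: glue_block.
move=> q qb; have := mmin _ (restr_on q qb.1).
by rewrite !HK//; [rewrite lee_fin lerD2r glue_restr//|exact: restr_on qb.1].
Qed.

Lemma partition_cells_cover (P : {set {set I}}) (s : seq {set I}) z :
  basic_partition mu Xs -> finset.partition P [set: I]%SET ->
  perm_eq s (enum P) -> exists2 J, J \in s & z \in cellY Y Xs J.
Proof.
move=> [Xcov _ _] /and3P[/eqP Pcov _ _] /perm_mem sP.
have : z.1 \in (\bigcup_i Xs i)%SET by rewrite Xcov inE.
case/bigcupP => i _ zi.
have : i \in finset.cover P by rewrite Pcov inE.
case/bigcupP => J JP iJ; exists J; first by rewrite sP mem_enum.
by rewrite in_cellY; apply/bigcupP; exists i.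
Qed.

End Bridge.

Theorem proposition3p9 (R : realType) (X Y : finType)
  (mu : {ffun X -> R}) (nu : {ffun Y -> R})
  (mu_full : forall x, 0 < mu x) (nu_full : forall y, 0 < nu y)
  (c : X * Y -> R) (eps : R) (eps_gt0 : 0 < eps)
  (phi1 phi2 : R -> \bar R)
  (phi1_entropy : entropy_function phi1) (phi2_entropy : entropy_function phi2)
  (phi1_ge0 : forall x, (0 <= phi1 x)%E) (phi2_ge0 : forall x, (0 <= phi2 x)%E)
  (phi1_fin : forall x : R, 0 <= x -> (phi1 x < +oo)%E)
  (phi2_fin : forall x : R, 0 <= x -> (phi2 x < +oo)%E)
  (phi1_C1 : C1_on_interior_dom phi1) (phi2_C1 : C1_on_interior_dom phi2)
  (I : finType) (Xs : I -> {set X}) (Xs_basic : basic_partition mu Xs)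
  (JA JB : {set {set I}})
  (JA_part : finset.partition JA [set: I]%SET) (JB_part : finset.partition JB [set: I]%SET)
  (orderA orderB : seq {set I})
  (orderA_JA : perm_eq orderA (enum JA)) (orderB_JB : perm_eq orderB (enum JB))
  (pi_init : {ffun X * Y -> R}) (pi_init_ge0 : Mplus pi_init)
  (pi_init_feasible : (E_glob c eps phi1 phi2 mu nu pi_init < +oo)%E) :
  exists pi_star : {ffun X * Y -> R},
    unique (is_minimizer Mplus (E_glob c eps phi1 phi2 mu nu)) pi_star /\
    forall z : X * Y,
      domdec c eps phi1 phi2 mu nu Xs orderA orderB pi_init k z @[k --> \oo]
        --> pi_star z.
Proof.
have phi1_reg := entropy_function_regular phi1_entropy phi1_ge0 phi1_fin phi1_C1.
have phi2_reg := entropy_function_regular phi2_entropy phi2_ge0 phi2_fin phi2_C1.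
have glob p : Mplus p -> _ := @E_glob_uot _ _ _ _ _ mu_full nu_full c eps _ _
  phi1_ge0 phi2_ge0 phi1_fin phi2_fin p.
(* A marginal mass is a positive form of a positive plan only if the other space
   is inhabited; when [X * Y] is empty there is only one plan. *)
case: (pickP (fun _ : X * Y => true)) => [z0 _|noZ]; last first.
  have ffun_eq (p q : {ffun X * Y -> R}) : p = q.
    by apply/ffunP => z; have := noZ z.
  exists pi_init; split; last by move=> z; have := noZ z.
  split; last by move=> q _; exact: ffun_eq.
  by split=> // q _; rewrite (ffun_eq q pi_init).
have updP p J (p0 : Mplus p) := cell_update_block_min mu_full nu_full c eps_gt0
  phi1_ge0 phi2_ge0 phi1_fin phi2_fin Xs phi1_reg phi2_reg J p0.
pose o k := if odd k.+1 then orderA else orderB.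
have oA n : o n.*2 = orderA by rewrite /o /= odd_double.
have [p [p0 pmin puniq pcvg]] := cyclic_sweeps_converge eps_gt0
  (prod_meas_gt0 mu_full nu_full) (marg_weight_ge0 mu_full nu_full)
  (marg_coef_ge0 mu_full nu_full) (marg_coef_row mu_full nu_full z0)
  (marg_entropy_regular phi1_reg phi2_reg) (fun p J => @updP p J)
  (fun z => partition_cells_cover z Xs_basic JA_part orderA_JA) oA
  (x := domdec c eps phi1 phi2 mu nu Xs orderA orderB pi_init)
  pi_init_ge0 (fun k => erefl).
exists p; split=> //; split.
  by split=> // q q0; rewrite !glob// lee_fin; exact: pmin.
move=> q [q0 qmin]; apply/esym/puniq => //.
by have := qmin p p0; rewrite !glob// lee_fin.
Qed.
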